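(* Let $f_t=\prod_{n\ge 1}(1-q^{nt})$ and define integers $p_j(n)$ by $f_1^{j}=\sum_{n\ge0}p_j(n)q^n$. Let $A_k(\alpha)$ and $B_k(\alpha)$ ($1\le k\le 3$, $\alpha\ge 0$) be the integer sequences which, for each fixed $k$, both satisfy the recurrence $$s(\alpha+4)=f(k)\,s(\alpha+2)+g(k)\,s(\alpha)\qquad(\alpha\ge 0),$$ where $f(1)=-2^3,\ g(1)=0$; $f(2)=2^3\cdot 13,\ g(2)=-2^{14}$; $f(3)=-2^6\cdot5\cdot 11,\ g(3)=-2^{22}$, with the initial values - $k=1$: $A_1(0)=1,\ A_1(1)=-8,\ A_1(2)=-8,\ A_1(3)=64$, and $B_1(\alpha)=0$ for all $\alpha$; - $k=2$: $A_2(0)=1,\ A_2(1)=128,\ A_2(2)=104,\ A_2(3)=-3072$; $B_2(0)=0,\ B_2(1)=1,\ B_2(2)=-2048,\ B_2(3)=104$; - $k=3$: $A_3(0)=1,\ A_3(1)=-2048,\ A_3(2)=-1472,\ A_3(3)=3014656$; $B_3(0)=0,\ B_3(1)=-24,\ B_3(2)=49152,\ B_3(3)=84480$. Then for every $\alpha\ge 0$ and $1\le k\le 3$, as formal Laurent series in $q$, $$\sum_{n=0}^\infty p_{8k}\Big(2^{2\alpha}n+\frac{k(2^{2\alpha}-1)}{3}\Big)q^n=A_k(2\alpha)f_1^{8k}+B_k(2\alpha)\,q^{\lfloor k/2\rfloor}f_1^{8k-24}f_2^{24}$$ and $$\sum_{n=-\lfloor k/2\rfloor}^\infty p_{8k}\Big(2^{2\alpha+1}n+\frac{k(2^{2\alpha+2}-1)}{3}\Big)q^n=A_k(2\alpha+1)f_2^{8k}+B_k(2\alpha+1)\,q^{-\lfloor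 k/2\rfloor}f_1^{24}f_2^{8k-24}.$$
   Context: All identities are between formal Laurent series in $q$ with integer coefficients; negative powers of $f_t$ are the inverses of $f_t$ in the ring of formal power series. *)

(* Defs.v *)
From HB Require Import structures.
From mathcomp Require Import all_boot all_order all_algebra.
From mathcomp Require Import boolp.
From mathcomp Require Import zify.

Set Implicit Arguments.
Unset Strict Implicit.
Unset Printing Implicit Defensive.

Import Order.TTheory GRing.Theory Num.Theory.

Local Open Scope ring_scope.

Record fps := Fps { fps_coef :> nat -> int }.

Lemma fpsP (a b : fps) : (forall n, a n = b n) -> a = b.
Proof. by case: a b => [a] [b] /= /funext ->. Qed.

HB.instance Definition _ := gen_eqMixin fps.
HB.instance Definition _ := gen_choiceMixin fps.

Definition fps_zero := Fps (fun=> 0).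
Definition fps_add (a b : fps) := Fps (fun n => a n + b n).
Definition fps_opp (a : fps) := Fps (fun n => - a n).
Definition fps_one := Fps (fun n => (n == 0)%:R).
Definition fps_mul (a b : fps) :=
  Fps (fun n => \sum_(i < n.+1) a i * b (n - i)%N).

Lemma fps_addA : associative fps_add.
Proof. by move=> a b c; apply: fpsP => n /=; rewrite addrA. Qed.
Lemma fps_addC : commutative fps_add.
Proof. by move=> a b; apply: fpsP => n /=; rewrite addrC. Qed.
Lemma fps_add0 : left_id fps_zero fps_add.
Proof. by move=> a; apply: fpsP => n /=; rewrite add0r. Qed.
Lemma fps_addN : left_inverse fps_zero fps_opp fps_add.
Proof. by move=> a; apply: fpsP => n /=; rewrite addNr. Qed.

HB.instance Definition _ :=
  GRing.isZmodule.Build fps fps_addA fps_addC fps_add0 fps_addN.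

Definition fps_trunc (N : nat) (a : fps) : {poly int} := \poly_(i < N) a i.

Lemma fps_mul_trunc N (a b : fps) n : (n < N)%N ->
  fps_mul a b n = (fps_trunc N a * fps_trunc N b)`_n.
Proof.
move=> ltnN; rewrite coefM /=; apply: eq_bigr => i _.
have lein : (i <= n)%N by rewrite -ltnS.
by rewrite !coef_poly !(leq_ltn_trans _ ltnN) ?leq_subr.
Qed.

Lemma fps_mulC : commutative fps_mul.
Proof.
by move=> a b; apply: fpsP => n; rewrite !(@fps_mul_trunc n.+1) // mulrC.
Qed.

Lemma coefM_eql (p p' r : {poly int}) n :
  (forall i, (i <= n)%N -> p`_i = p'`_i) -> (p * r)`_n = (p' * r)`_n.
Proof.
by move=> eqp; rewrite !coefM; apply: eq_bigr => i _; rewrite eqp // -ltnS.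
Qed.

Lemma fps_trunc_mul N (a b : fps) i : (i < N)%N ->
  (fps_trunc N (fps_mul a b))`_i = (fps_trunc N a * fps_trunc N b)`_i.
Proof. by move=> ltiN; rewrite coef_poly ltiN (@fps_mul_trunc N). Qed.

Lemma fps_mulA : associative fps_mul.
Proof.
move=> a b c; apply: fpsP => n; rewrite !(@fps_mul_trunc n.+1) //.
rewrite mulrC (coefM_eql _ (fun i (le : (i <= n)%N) => @fps_trunc_mul n.+1 b c i le)).
rewrite [RHS](coefM_eql _ (fun i (le : (i <= n)%N) => @fps_trunc_mul n.+1 a b i le)).
by rewrite mulrC mulrA.
Qed.

Lemma fps_mul1 : left_id fps_one fps_mul.
Proof.
move=> a; apply: fpsP => n /=; rewrite big_ord_recl /= mul1r subn0.
by rewrite big1 ?addr0 // => i _; rewrite mul0r.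
Qed.

Lemma fps_mulDl : left_distributive fps_mul fps_add.
Proof.
move=> a b c; apply: fpsP => n /=; rewrite -big_split /=.
by apply: eq_bigr => i _; rewrite mulrDl.
Qed.

Lemma fps_one_neq0 : fps_one != fps_zero.
Proof. by apply/eqP => /(congr1 (fun a : fps => a 0%N)). Qed.

HB.instance Definition _ := GRing.Zmodule_isComNzRing.Build fps
  fps_mulA fps_mulC fps_mul1 fps_mulDl fps_one_neq0.

Lemma fps_coef0 n : (0 : fps) n = 0. Proof. by []. Qed.
Lemma fps_coef1 n : (1 : fps) n = (n == 0)%:R. Proof. by []. Qed.
Lemma fps_coefD (a b : fps) n : (a + b) n = a n + b n. Proof. by []. Qed.
Lemma fps_coefN (a : fps) n : (- a) n = - a n. Proof. by []. Qed.
Lemma fps_coefB (a b : fps) n : (a - b) n = a n - b n. Proof. by []. Qed.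
Lemma fps_coefM (a b : fps) n :
  (a * b) n = \sum_(i < n.+1) a i * b (n - i)%N.
Proof. by []. Qed.

(** A series is invertible iff its constant term is; the coefficients of the
    inverse [b] of [a] solve [\sum_(i <= n) b_i * a_(n - i) = (n == 0)].
    [fps_inv_seq a n] lists the first [n] of them. *)

Fixpoint fps_inv_seq (a : fps) (n : nat) : seq int :=
  if n is m.+1 then
    let s := fps_inv_seq a m in
    rcons s (((m == 0)%:R - \sum_(i < m) s`_i * a (m - i)%N) * (a 0%N)^-1)
  else [::].

Definition fps_unit : pred fps := fun a => a 0%N \is a GRing.unit.

Definition fps_inv (a : fps) : fps :=
  if fps_unit a then Fps (fun n => (fps_inv_seq a n.+1)`_n) else a.

Lemma size_fps_inv_seq a n : size (fps_inv_seq a n) = n.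
Proof. by elim: n => //= n IHn; rewrite size_rcons IHn. Qed.

Lemma nth_fps_inv_seq a n i :
  (i < n)%N -> (fps_inv_seq a n)`_i = (fps_inv_seq a i.+1)`_i.
Proof.
elim: n => // n IHn; rewrite ltnS leq_eqVlt => /predU1P[-> // | ltin].
by rewrite -IHn //= nth_rcons size_fps_inv_seq ltin.
Qed.

Lemma fps_mulV : {in fps_unit, left_inverse 1 fps_inv *%R}.
Proof.
move=> a a_unit; have ua : a 0%N \is a GRing.unit := a_unit.
apply: fpsP => n; rewrite fps_coefM /fps_inv ifT // fps_coef1.
rewrite big_ord_recr /= subnn nth_rcons size_fps_inv_seq ltnn eqxx divrK //.
rewrite [X in X + _](_ : _ = \sum_(i < n) (fps_inv_seq a n)`_i * a (n - i)%N).
  by rewrite addrC subrK.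
by apply: eq_bigr => i _; rewrite (nth_fps_inv_seq _ (ltn_ord i)).
Qed.

Lemma fps_unitPl (a b : fps) : b * a = 1 -> fps_unit a.
Proof.
move=> /(congr1 (fun c : fps => c 0%N)).
rewrite fps_coefM big_ord1 subnn fps_coef1 eqxx => ba1.
by apply/unitrPr; exists (b 0%N); rewrite mulrC.
Qed.

Lemma fps_inv_out : {in [predC fps_unit], fps_inv =1 id}.
Proof. by move=> a /negPf; rewrite /fps_inv /in_mem /= => ->. Qed.

HB.instance Definition _ := GRing.ComNzRing_hasMulInverse.Build fps
  fps_mulV fps_unitPl fps_inv_out.

Lemma fps_unitE (a : fps) : (a \is a GRing.unit) = (a 0%N \is a GRing.unit).
Proof. by []. Qed.

Definition fps_q : fps := Fps (fun n => (n == 1)%:R).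

Lemma fps_coef_qXn m n : (fps_q ^+ m) n = (n == m)%:R.
Proof.
elim: m n => [|m IHm] n; first by rewrite expr0.
rewrite exprS fps_coefM; case: n => [|n].
  by rewrite big_ord1 /= mul0r.
rewrite 2!big_ord_recl big1 /= ?mul0r ?mul1r ?add0r ?addr0 ?IHm ?subSS ?subn0 //.
by move=> i _; rewrite mul0r.
Qed.

Lemma fps_coef_qXnM m (a : fps) n :
  (fps_q ^+ m * a) n = if (n < m)%N then 0 else a (n - m)%N.
Proof.
rewrite fps_coefM; case: ltnP => [ltnm | lemn].
  by apply: big1 => i _; rewrite fps_coef_qXn ltn_eqF ?mul0r //; have := ltn_ord i; lia.
have ltmn : (m < n.+1)%N by [].
rewrite (bigD1 (Ordinal ltmn)) //= fps_coef_qXn eqxx mul1r big1 ?addr0 // => i.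
by rewrite -val_eqE /= fps_coef_qXn => /negPf->; rewrite mul0r.
Qed.

Record laurent := Laurent {
  lau_coef :> int -> int;
  lau_bounded : exists m : int, forall n, n < m -> lau_coef n = 0 }.

Lemma laurentP (a b : laurent) : (forall n, a n = b n) -> a = b.
Proof.
case: a b => [a Ha] [b Hb] /= /funext eqab; rewrite -{}eqab in Hb *.
by rewrite (Prop_irrelevance Ha Hb).
Qed.

HB.instance Definition _ := gen_eqMixin laurent.
HB.instance Definition _ := gen_choiceMixin laurent.

(** The sum of [c n * q ^ n] over the integers [n >= m]. *)
Fact lau_series_subproof (m : int) (c : int -> int) :
  exists m' : int, forall n, n < m' -> (if m <= n then c n else 0) = 0.
Proof. by exists m => n ltnm; rewrite leNgt ltnm. Qed.

Definition lau_series (m : int) (c : int -> int) : laurent :=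
  Laurent (lau_series_subproof m c).

(** [lau_shift m a] is [q ^ m * a]. *)
Definition lau_shift (m : int) (a : fps) : laurent :=
  lau_series m (fun n => a `|n - m|%N).

Lemma lau_shiftE m a n :
  lau_shift m a n = if m <= n then a `|n - m|%N else 0.
Proof. by []. Qed.

Definition lau_of_fps (a : fps) : laurent := lau_shift 0 a.
Definition lau_qX (m : int) : laurent := lau_shift m 1.

Fact lau_add_subproof (a b : laurent) :
  exists m : int, forall n, n < m -> a n + b n = 0.
Proof.
have [[ma Ha] [mb Hb]] := (lau_bounded a, lau_bounded b).
exists (Num.min ma mb) => n; rewrite lt_min => /andP[/Ha-> /Hb->].
by rewrite addr0.
Qed.

Fact lau_opp_subproof (a : laurent) :
  exists m : int, forall n, n < m -> - a n = 0.
Proof. by have [m Ha] := lau_bounded a; exists m => n /Ha->; rewrite oppr0. Qed.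

Definition lau_add (a b : laurent) := Laurent (lau_add_subproof a b).
Definition lau_opp (a : laurent) := Laurent (lau_opp_subproof a).

(** Choosing lower bounds [m] and [m'] of the supports of [a] and [b], write
    [a = q ^ m * a'] and [b = q ^ m' * b'] with [a'] and [b'] in Z[[q]]; then
    [a * b = q ^ (m + m') * (a' * b')].  This does not depend on the bounds,
    see [lau_shiftM]. *)
Definition lau_low (a : laurent) : int := projT1 (cid (lau_bounded a)).
Definition lau_part (m : int) (a : laurent) : fps :=
  Fps (fun i => a (m + i%:Z)).
Definition lau_mul (a b : laurent) : laurent :=
  lau_shift (lau_low a + lau_low b)
    (lau_part (lau_low a) a * lau_part (lau_low b) b).

Lemma lau_addA : associative lau_add.
Proof. by move=> a b c; apply: laurentP => n /=; rewrite addrA. Qed.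
Lemma lau_addC : commutative lau_add.
Proof. by move=> a b; apply: laurentP => n /=; rewrite addrC. Qed.
Lemma lau_add0 : left_id (lau_of_fps 0) lau_add.
Proof. by move=> a; apply: laurentP => n /=; rewrite if_same add0r. Qed.
Lemma lau_addN : left_inverse (lau_of_fps 0) lau_opp lau_add.
Proof. by move=> a; apply: laurentP => n /=; rewrite if_same addNr. Qed.

HB.instance Definition _ :=
  GRing.isZmodule.Build laurent lau_addA lau_addC lau_add0 lau_addN.

Lemma lau_shift_part m (a : laurent) :
  (forall n, n < m -> a n = 0) -> a = lau_shift m (lau_part m a).
Proof.
move=> Ha; apply: laurentP => n /=.
case: leP => [lemn | /Ha //]; congr (a _); lia.
Qed.

Lemma lau_shift_low (a : laurent) :
  a = lau_shift (lau_low a) (lau_part (lau_low a) a).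
Proof. by apply: lau_shift_part; rewrite /lau_low; case: cid. Qed.

Lemma lau_shift_inj m : injective (lau_shift m).
Proof.
move=> a b eqab; apply: fpsP => n.
have /= := congr1 (fun c : laurent => c (m + n%:Z)) eqab.
by rewrite lerDl addrAC subrr add0r.
Qed.

Lemma lau_shift_qXn m k (a : fps) :
  lau_shift (m - k%:Z) (fps_q ^+ k * a) = lau_shift m a.
Proof.
apply: laurentP => n; rewrite !lau_shiftE fps_coef_qXnM.
case: (leP m n) => lemn; case: (leP (m - k%:Z) n) => // lemkn; try lia.
  rewrite ifF; first by congr (a _); lia.
  by apply/negbTE; lia.
by rewrite ifT //; lia.
Qed.

Lemma lau_shift_eq m m' (a a' : fps) : lau_shift m a = lau_shift m' a' ->
  exists k k' : nat,
    m - k%:Z = m' - k'%:Z /\ fps_q ^+ k * a = fps_q ^+ k' * a'.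
Proof.
move=> eqa; pose K := Num.min m m'.
have [leKm leKm'] : K <= m /\ K <= m' by rewrite !ge_min !lexx orbT.
exists `|m - K|%N, `|m' - K|%N; have eqK : m - `|m - K|%N%:Z = m' - `|m' - K|%N%:Z by lia.
split=> //; apply: (@lau_shift_inj (m - `|m - K|%N%:Z)).
by rewrite lau_shift_qXn eqK lau_shift_qXn.
Qed.

Lemma lau_mul_shift m m' (a b : fps) :
  lau_mul (lau_shift m a) (lau_shift m' b) = lau_shift (m + m') (a * b).
Proof.
rewrite /lau_mul; set A := lau_shift m a; set B := lau_shift m' b.
have [k [k' [ek eA]]] := lau_shift_eq (esym (lau_shift_low A)).
have [l [l' [el eB]]] := lau_shift_eq (esym (lau_shift_low B)).
rewrite -(lau_shift_qXn _ (k + l)) -[RHS](lau_shift_qXn _ (k' + l')).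
congr lau_shift; first by rewrite !PoszD; lia.
by rewrite !exprD mulrACA eA eB mulrACA.
Qed.

Lemma lau_shift_surj (a b c : laurent) : exists m (a' b' c' : fps),
  [/\ a = lau_shift m a', b = lau_shift m b' & c = lau_shift m c'].
Proof.
have [[ma Ha] [mb Hb] [mc Hc]] :=
  And3 (lau_bounded a) (lau_bounded b) (lau_bounded c).
pose m := Num.min ma (Num.min mb mc).
exists m, (lau_part m a), (lau_part m b), (lau_part m c).
split; apply: lau_shift_part => n; rewrite /m !lt_min => /and3P[na nb nc].
- exact: Ha.
- exact: Hb.
- exact: Hc.
Qed.

Lemma lau_shiftD m (a b : fps) :
  lau_shift m (a + b) = lau_shift m a + lau_shift m b.
Proof. by apply: laurentP => n /=; case: ifP => _; rewrite ?addr0. Qed.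

Lemma lau_mulA : associative lau_mul.
Proof.
move=> a b c; have [m [a' [b' [c' [-> -> ->]]]]] := lau_shift_surj a b c.
by rewrite !lau_mul_shift addrA mulrA.
Qed.

Lemma lau_mulC : commutative lau_mul.
Proof.
move=> a b; have [m [a' [b' [_ [-> -> _]]]]] := lau_shift_surj a b 0.
by rewrite !lau_mul_shift mulrC.
Qed.

Lemma lau_mul1 : left_id (lau_of_fps 1) lau_mul.
Proof.
move=> a; have [m [a' [_ [_ [-> _ _]]]]] := lau_shift_surj a 0 0.
by rewrite lau_mul_shift add0r mul1r.
Qed.

Lemma lau_mulDl : left_distributive lau_mul lau_add.
Proof.
move=> a b c; have [m [a' [b' [c' [-> -> ->]]]]] := lau_shift_surj a b c.
by rewrite -[lau_add _ _]lau_shiftD !lau_mul_shift mulrDl lau_shiftD.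
Qed.

Lemma lau_one_neq0 : lau_of_fps 1 != 0.
Proof. by apply/eqP => /lau_shift_inj/eqP; rewrite oner_eq0. Qed.

HB.instance Definition _ := GRing.Zmodule_isComNzRing.Build laurent
  lau_mulA lau_mulC lau_mul1 lau_mulDl lau_one_neq0.

Lemma lau_shiftM m m' (a b : fps) :
  lau_shift m a * lau_shift m' b = lau_shift (m + m') (a * b).
Proof. exact: lau_mul_shift. Qed.

Lemma lau_of_fps_is_zmod_morphism : zmod_morphism lau_of_fps.
Proof.
move=> a b; apply: laurentP => n /=.
by case: ifP => _ //=; rewrite subr0.
Qed.

Lemma lau_of_fps_is_monoid_morphism : monoid_morphism lau_of_fps.
Proof. by split=> // a b; rewrite /lau_of_fps lau_shiftM addr0. Qed.

HB.instance Definition _ :=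
  GRing.isZmodMorphism.Build fps laurent lau_of_fps lau_of_fps_is_zmod_morphism.
HB.instance Definition _ :=
  GRing.isMonoidMorphism.Build fps laurent lau_of_fps
    lau_of_fps_is_monoid_morphism.

Lemma lau_qX0 : lau_qX 0 = 1. Proof. by []. Qed.

Lemma lau_qXD m m' : lau_qX (m + m') = lau_qX m * lau_qX m'.
Proof. by rewrite /lau_qX lau_shiftM mulr1. Qed.

Lemma lau_qXM m (a : fps) : lau_qX m * lau_of_fps a = lau_shift m a.
Proof. by rewrite lau_shiftM addr0 mul1r. Qed.

(** For [t > 0] the factors with [i > n] do not affect the coefficient of
    [q ^ n], see [f_coefE]. *)
Definition f_ (t : nat) : fps :=
  Fps (fun n => (\prod_(1 <= i < n.+1) (1 - fps_q ^+ (i * t))) n).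

Lemma f_coefE t n N : (0 < t)%N -> (n <= N)%N ->
  f_ t n = (\prod_(1 <= i < N.+1) (1 - fps_q ^+ (i * t))) n.
Proof.
move=> t_gt0; elim: N => [|N IHN]; first by rewrite leqn0 => /eqP->.
rewrite leq_eqVlt => /predU1P[-> // | ltnN].
set F := fun i => 1 - fps_q ^+ (i * t).
have -> : \prod_(1 <= i < N.+2) F i = F N.+1 * \prod_(1 <= i < N.+1) F i.
  by rewrite big_nat_recr //= mulrC.
rewrite {1}/F mulrBl mul1r fps_coefB fps_coef_qXnM ifT ?subr0 ?IHN //.
by apply: leq_trans (leq_pmulr _ t_gt0).
Qed.

Lemma f_unit t : f_ t \is a GRing.unit.
Proof. by rewrite fps_unitE /= big_geq. Qed.

(** [p_ j n] is the coefficient of [q ^ n] in [f_ 1 ^ j], hence 0 if [n < 0]. *)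
Definition p_ (j n : int) : int := lau_of_fps (f_ 1 ^ j) n.

Definition frec (k : nat) : int :=
  match k with
  | 1 => - 2 ^+ 3
  | 2 => 2 ^+ 3 * 13
  | 3 => - (2 ^+ 6 * 5 * 11)
  | _ => 0
  end.

Definition grec (k : nat) : int :=
  match k with
  | 1 => 0
  | 2 => - 2 ^+ 14
  | 3 => - 2 ^+ 22
  | _ => 0
  end.

Definition satisfies_rec (k : nat) (s : nat -> int) : Prop :=
  forall alpha, s (alpha + 4)%N = frec k * s (alpha + 2)%N + grec k * s alpha.

(* Main.v *)
Require Import Defs.
From HB Require Import structures.
From mathcomp Require Import all_boot all_order all_algebra.
From mathcomp Require Import zify ring.

(** Extracting the even- or odd-indexed coefficients maps each of the families
    [even_form], [odd_form] (the right-hand sides of the two identities) into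
    the other, linearly in the coefficient pair; the recurrences for [A] and [B]
    are the resulting two-step matrix recurrences.  With [q -> -q] written
    [flip], the action on the families follows from two facts on
    [f_1^8 = a(q^2) + q b(q^2)]: the product identity
    [f_1 * flip f_1 = f_2^3 / f_4], which gives [a^2 - q b^2 = f_1^24 / f_2^8],
    and [b = - 8 f_2^8].  For the latter, let [theta = sum_(n in Z) q^(n^2)] and
    [psi = sum_(n >= 0) q^(n(n+1)/2)].  Gauss's [flip theta = f_1^2 / f_2] comes
    from a finite identity of Shanks.  Splitting [theta * flip theta =
    (flip theta)(q^2)^2] by parity gives [psi^2 = theta * psi(q^2)], which forces
    [psi = f_2^2 / f_1], and the odd part of [(flip theta)^4] is
    [- 8 q psi(q^2)^4]. *)

Import GRing.Theory Num.Theory.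
Local Open Scope ring_scope.

Set Implicit Arguments.
Unset Strict Implicit.
Unset Printing Implicit Defensive.

(** * Parity sections, the dilation q -> q^2 and the sign change q -> -q *)

Definition section (r : nat) (a : fps) : fps := Fps (fun n => a (2 * n + r)%N).

Definition dilate (a : fps) : fps :=
  Fps (fun n => if odd n then 0 else a n./2).

Definition flip (a : fps) : fps := Fps (fun n => (-1) ^+ n * a n).

Lemma fpsP2 (a b : fps) :
  section 0 a = section 0 b -> section 1 a = section 1 b -> a = b.
Proof.
move=> e0 e1; apply: fpsP => n.
have e r : section r a = section r b -> a (2 * n./2 + r)%N = b (2 * n./2 + r)%N.
  by move=> /(congr1 (fun c : fps => c n./2)).
rewrite (_ : n = 2 * n./2 + odd n)%N; last lia.
by case: (odd n); apply: e.
Qed.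

Fact section_is_zmod_morphism r : zmod_morphism (section r).
Proof. by move=> a b; apply: fpsP => n. Qed.
HB.instance Definition _ r :=
  GRing.isZmodMorphism.Build fps fps (section r) (section_is_zmod_morphism r).

Lemma sum_even (F : nat -> int) n : (forall i, odd i -> F i = 0) ->
  \sum_(i < n.+1) F i = \sum_(i < n./2.+1) F (2 * i)%N.
Proof.
move=> F0; move: (odd n) n./2 (odd_double_half n) => b k <-.
have e m : \sum_(i < m.*2.+1) F i = \sum_(i < m.+1) F (2 * i)%N.
  elim: m => [|m IHm]; first by rewrite !big_ord1.
  rewrite doubleS big_ord_recr [in RHS]big_ord_recr /= big_ord_recr /= IHm.
  by rewrite F0 /= ?odd_double // addr0 mul2n.
case: b; last exact: e.
by rewrite add1n big_ord_recr /= e F0 /= ?odd_double // addr0.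
Qed.

(** Only the even indices of [dilate a] contribute to the convolution, and for [r < 2] half of
    [2 * n + r] is [n]. Sections are thus linear over series in q^2. *)
Lemma section_dilateM r (a b : fps) : (r < 2)%N ->
  section r (dilate a * b) = a * section r b.
Proof.
move=> r2; apply: fpsP => n; rewrite /= [LHS](@sum_even (fun i => dilate a i * b (2 * n + r - i)%N)).
  rewrite (_ : (2 * n + r)./2 = n); last lia.
  apply: eq_bigr => i _ /=; rewrite oddM /= mul2n doubleK; congr (_ * b _).
  by have := ltn_ord i; lia.
by move=> i /= ->; rewrite mul0r.
Qed.

Lemma section0_dilate a : section 0 (dilate a) = a.
Proof. by apply: fpsP => n /=; rewrite addn0 oddM mul2n doubleK. Qed.

Lemma section1_dilate a : section 1 (dilate a) = 0.
Proof. by apply: fpsP => n /=; rewrite addn1 oddS oddM. Qed.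

Lemma section0_qM a : section 0 (fps_q * dilate a) = 0.
Proof.
rewrite mulrC section_dilateM // (_ : section 0 fps_q = 0) ?mulr0 //.
by apply: fpsP => n /=; rewrite addn0; case: eqP => //; lia.
Qed.

Lemma section1_qM a : section 1 (fps_q * dilate a) = a.
Proof.
rewrite mulrC section_dilateM // (_ : section 1 fps_q = 1) ?mulr1 //.
by apply: fpsP => n /=; congr (_%:R); congr nat_of_bool; lia.
Qed.

Fact dilate_is_zmod_morphism : zmod_morphism dilate.
Proof. by move=> a b; apply: fpsP => n /=; case: odd; rewrite ?subr0. Qed.
HB.instance Definition _ :=
  GRing.isZmodMorphism.Build fps fps dilate dilate_is_zmod_morphism.

Fact dilate_is_monoid_morphism : monoid_morphism dilate.
Proof.
split; first by apply: fpsP => -[|[|n]] //=; rewrite ?if_same.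
move=> a b; apply: fpsP2; rewrite section_dilateM //.
  by rewrite !section0_dilate.
by rewrite !section1_dilate mulr0.
Qed.
HB.instance Definition _ :=
  GRing.isMonoidMorphism.Build fps fps dilate dilate_is_monoid_morphism.

Lemma dilate_inj : injective dilate.
Proof. by apply: can_inj section0_dilate. Qed.

Lemma dilate_q : dilate fps_q = fps_q ^+ 2.
Proof.
apply: fpsP => n; rewrite fps_coef_qXn /=; have := odd_double_half n.
by case: (odd n) => <-; [case: eqP => //; lia | congr (_%:R); lia].
Qed.

Fact flip_is_zmod_morphism : zmod_morphism flip.
Proof. by move=> a b; apply: fpsP => n /=; rewrite mulrBr. Qed.
HB.instance Definition _ :=
  GRing.isZmodMorphism.Build fps fps flip flip_is_zmod_morphism.

Fact flip_is_monoid_morphism : monoid_morphism flip.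
Proof.
split=> [|a b]; apply: fpsP => n.
  by case: n => [|n] /=; rewrite ?mulr1 ?mulr0.
rewrite /= mulr_sumr; apply: eq_bigr => i _.
by rewrite -{1}(subnKC (ltn_ord i : i <= n)%N) exprD /=; ring.
Qed.
HB.instance Definition _ :=
  GRing.isMonoidMorphism.Build fps fps flip flip_is_monoid_morphism.

Lemma flipK : involutive flip.
Proof. by move=> a; apply: fpsP => n /=; rewrite mulrA -expr2 sqrr_sign mul1r. Qed.

Lemma flip_q : flip fps_q = - fps_q.
Proof. by apply: fpsP => -[|[|n]] //=; rewrite ?mulr0 // oppr0. Qed.

Lemma flip_dilate a : flip (dilate a) = dilate a.
Proof.
apply: fpsP => n /=; rewrite -signr_odd.
by case: (odd n); rewrite ?mulr0 ?mul1r.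
Qed.

Lemma parity_split a :
  a = dilate (section 0 a) + fps_q * dilate (section 1 a).
Proof.
apply: fpsP2; rewrite raddfD /=.
  by rewrite section0_dilate section0_qM addr0.
by rewrite section1_dilate section1_qM add0r.
Qed.

Lemma mulr_flip a :
  a * flip a = dilate (section 0 a ^+ 2 - fps_q * section 1 a ^+ 2).
Proof.
rewrite {1 2}(parity_split a) rmorphD rmorphM /= flip_q !flip_dilate.
by rewrite rmorphB rmorphXn (rmorphM _ fps_q) rmorphXn /= dilate_q; ring.
Qed.

(* Congruence modulo [q ^ N]. *)
Definition congq (N : nat) (a b : fps) : Prop := fps_trunc N a = fps_trunc N b.

Lemma congqE N a b : congq N a b <-> (forall n, (n < N)%N -> a n = b n).
Proof.
split=> [ab n ltnN | ab].
  by have := congr1 (fun p : {poly int} => p`_n) ab; rewrite /= !coef_poly ltnN.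
by apply/polyP => n; rewrite !coef_poly; case: ifP => // /ab.
Qed.

Lemma congqM N a b c d : congq N a b -> congq N c d -> congq N (a * c) (b * d).
Proof.
move=> /congqE ab /congqE cd; apply/congqE => n ltnN.
rewrite !fps_coefM; apply: eq_bigr => i _; have := ltn_ord i => lei.
by rewrite ab ?cd //; lia.
Qed.

Lemma congq_dilate N a b : congq N a b -> congq N (dilate a) (dilate b).
Proof.
move=> /congqE ab; apply/congqE => n ltnN /=.
by case: odd; rewrite ?ab //; lia.
Qed.

Lemma congq_flip N a b : congq N a b -> congq N (flip a) (flip b).
Proof. by move=> /congqE ab; apply/congqE => n ltnN /=; rewrite ab. Qed.

Lemma congqS M N a b : (M <= N)%N -> congq N a b -> congq M a b.
Proof.
by move=> leMN /congqE ab; apply/congqE => n ltnM; apply: ab; apply: leq_trans leMN.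
Qed.

Lemma congq_eq a b : (forall N, congq N a b) -> a = b.
Proof. by move=> ab; apply: fpsP => n; have /congqE := ab n.+1; apply. Qed.

(** * Truncated Euler products and the product of [f_ 1] with its flip *)

Definition fpart (t N : nat) : fps := \prod_(1 <= i < N.+1) (1 - fps_q ^+ (i * t)).

Lemma congq_f t N : (0 < t)%N -> congq N (f_ t) (fpart t N).
Proof. by move=> t0; apply/congqE => n ltn; apply: f_coefE => //; apply: ltnW. Qed.

Lemma dilate_f t : (0 < t)%N -> dilate (f_ t) = f_ (2 * t).
Proof.
move=> t0; apply: congq_eq => N.
apply: etrans (congq_dilate (congq_f N t0)) _.
suff -> : dilate (fpart t N) = fpart (2 * t) N.
  by apply: esym; apply: congq_f; lia.
rewrite rmorph_prod; apply: eq_bigr => i _.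
by rewrite rmorphB rmorph1 rmorphXn /= dilate_q -exprM; congr (1 - _ ^+ _); lia.
Qed.

(** For odd [i] the factors 1 - q^i and 1 + q^i give 1 - q^(2i), and [fpart 4 M] supplies the same
    for even [i], completing [fpart 2 M.*2]; the even [i] also contribute (1 - q^i)^2. With length
    [M.*2] each induction step adds one factor of each parity. *)
Lemma mulr_flip_fpart M :
  fpart 1 M.*2 * flip (fpart 1 M.*2) * fpart 4 M
  = fpart 2 M ^+ 2 * fpart 2 M.*2.
Proof.
elim: M => [|M IHM].
  by rewrite /fpart !big_geq // rmorph1 expr1n !mulr1.
have S t N : fpart t N.+1 = fpart t N * (1 - fps_q ^+ (N.+1 * t)).
  by rewrite /fpart big_nat_recr.
have eO : (- fps_q) ^+ M.*2.+1 = - fps_q ^+ M.*2.+1.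
  by rewrite exprNn -signr_odd /= odd_double expr1 mulN1r.
have eE : (- fps_q) ^+ M.*2.+2 = fps_q ^+ M.*2.+2.
  by rewrite exprNn -signr_odd /= odd_double expr0 mul1r.
rewrite doubleS !S !rmorphM !rmorphB /= !rmorph1 !rmorphXn /= flip_q !muln1.
rewrite (_ : M.+1 * 4 = M.*2.+2 * 2)%N; last lia.
rewrite (_ : M.+1 * 2 = M.*2.+2)%N; last lia.
rewrite eO eE !exprM; set y := flip _ in IHM *.
transitivity (fpart 1 M.*2 * y * fpart 4 M
  * ((1 - fps_q ^+ M.*2.+1) * (1 - fps_q ^+ M.*2.+2)
     * ((1 + fps_q ^+ M.*2.+1) * (1 - fps_q ^+ M.*2.+2))
     * (1 - (fps_q ^+ M.*2.+2) ^+ 2))); first by ring.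
by rewrite IHM; ring.
Qed.

Lemma f_flip : f_ 1 * flip (f_ 1) * f_ 4 = f_ 2 ^+ 3.
Proof.
apply: congq_eq => N.
have c1 : congq N (f_ 1) (fpart 1 N.*2).
  by apply: congqS (congq_f _ _); lia.
have c4 : congq N (f_ 4) (fpart 4 N) by apply: congq_f.
have c2 : congq N (f_ 2) (fpart 2 N) by apply: congq_f.
have c2' : congq N (f_ 2) (fpart 2 N.*2) by apply: congqS (congq_f _ _); lia.
apply: etrans (congqM (congqM c1 (congq_flip c1)) c4) _.
rewrite mulr_flip_fpart; apply: esym; rewrite exprSr !expr2.
exact: congqM (congqM c2 c2) c2'.
Qed.

(** * Shanks's finite identity *)

Definition ppart (N : nat) : fps := \prod_(1 <= i < N.+1) (1 + fps_q ^+ i).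

Lemma fps_q_coef0 n : (0 < n)%N -> (fps_q ^+ n) 0%N = 0.
Proof. by rewrite fps_coef_qXn; case: n. Qed.

Lemma unit_1Bq n : (0 < n)%N -> 1 - fps_q ^+ n \is a GRing.unit.
Proof. by move=> n0; rewrite fps_unitE fps_coefB fps_q_coef0. Qed.

Lemma unit_1Dq n : (0 < n)%N -> 1 + fps_q ^+ n \is a GRing.unit.
Proof. by move=> n0; rewrite fps_unitE fps_coefD fps_q_coef0. Qed.

Lemma fpartS t N : fpart t N.+1 = fpart t N * (1 - fps_q ^+ (N.+1 * t)).
Proof. by rewrite /fpart big_nat_recr. Qed.

Lemma ppartS N : ppart N.+1 = ppart N * (1 + fps_q ^+ N.+1).
Proof. by rewrite /ppart big_nat_recr. Qed.

Lemma fpart_unit N : fpart 1 N \is a GRing.unit.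
Proof.
elim: N => [|N IHN]; first by rewrite /fpart big_geq // unitr1.
by rewrite fpartS unitrM IHN muln1 unit_1Bq.
Qed.

Lemma ppart_unit N : ppart N \is a GRing.unit.
Proof.
elim: N => [|N IHN]; first by rewrite /ppart big_geq // unitr1.
by rewrite ppartS unitrM IHN unit_1Dq.
Qed.

Lemma fpart2 N : fpart 2 N = fpart 1 N * ppart N.
Proof.
elim: N => [|N IHN]; first by rewrite /fpart /ppart !big_geq // mulr1.
by rewrite !fpartS ppartS IHN muln1 exprM; ring.
Qed.

(** By [fpart2], a finite version of f_2 / f_1^2, the reciprocal of Gauss's product. *)
Definition gquot (N : nat) : fps := ppart N / fpart 1 N.

(** The lengths [s] and [s.+1] differ so that multiplying by 1 - q^(s+1) or by 1 + q^(s+1) yields,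
    up to a common sign, the consecutive quotients [gquot s] and [gquot s.+1]. *)
Definition gterm (s : nat) : fps := (-1) ^+ s.+1 * (ppart s / fpart 1 s.+1).

Lemma gtermMB s : gterm s * (1 - fps_q ^+ s.+1) = (-1) ^+ s.+1 * gquot s.
Proof.
rewrite /gterm /gquot fpartS muln1 invrM ?fpart_unit ?unit_1Bq //.
have := mulVr (unit_1Bq (ltn0Sn s)); set x := 1 - _ => e.
by rewrite -[RHS]mulr1 -[X in _ = _ * X]e; ring.
Qed.

Lemma gtermMD s : gterm s * (1 + fps_q ^+ s.+1) = (-1) ^+ s.+1 * gquot s.+1.
Proof. by rewrite /gterm /gquot ppartS; ring. Qed.

(* By [gtermMB] and [gtermMD] the sum telescopes. *)
Lemma sum_gterm n (Q : fps) :
  \sum_(s < n) gterm s * Q ^+ s.+1 * ((1 - Q) * fps_q ^+ s.+1 - (1 + Q))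
  = Q + (-1) ^+ n.+1 * Q ^+ n.+1 * gquot n.
Proof.
elim: n => [|n IHn].
  by rewrite big_ord0 /gquot /ppart /fpart !big_geq // divr1 expr1; ring.
rewrite big_ord_recr /= {}IHn.
rewrite (_ : gterm n * _ * _ =
  - (Q ^+ n.+1 * (gterm n * (1 - fps_q ^+ n.+1)))
  - Q ^+ n.+2 * (gterm n * (1 + fps_q ^+ n.+1))); last by rewrite (exprS Q n.+1); ring.
by rewrite gtermMB gtermMD (exprS (-1) n.+1); ring.
Qed.

(** Induction on [n]: with Q = q^(n+1), [sum_gterm n Q] relates the left-hand sums for [n] and
    [n.+1]. As [n] grows these sums vanish to order n + 1, which leaves Gauss's formula. *)
Lemma shanks n :
  (gquot n)^-1 * (1 + 2 * \sum_(s < n) gterm s * (fps_q ^+ n.+1) ^+ s.+1)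
  = 1 + 2 * \sum_(s < n) (-1) ^+ s.+1 * fps_q ^+ (s.+1 ^ 2).
Proof.
have gU m : gquot m \is a GRing.unit by rewrite unitrM unitrV ppart_unit fpart_unit.
elim: n => [|n IHn].
  by rewrite !big_ord0 /gquot /ppart /fpart !big_geq // divr1 invr1; ring.
rewrite [in RHS]big_ord_recr [in RHS]mulrDr [RHS]addrA -{}IHn /=.
set Q := fps_q ^+ n.+1.
have gS : gquot n.+1 * (1 - Q) = gquot n * (1 + Q).
  rewrite /gquot ppartS fpartS muln1 invrM ?fpart_unit ?unit_1Bq // -/Q.
  by rewrite -[RHS]mulr1 -[X in _ = _ * X](mulVr (unit_1Bq (ltn0Sn n))) -/Q; ring.
have t_n : gterm n * (1 - Q) = (-1) ^+ n.+1 * gquot n by apply: gtermMB.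
have /= := sum_gterm n Q.
rewrite (eq_bigr (fun s : 'I_n => (1 - Q) * (gterm s * (fps_q ^+ n.+2) ^+ s.+1)
   - (1 + Q) * (gterm s * (fps_q ^+ n.+1) ^+ s.+1))); last first.
  move=> s _; rewrite -/Q (_ : (fps_q ^+ n.+2) ^+ s.+1 = Q ^+ s.+1 * fps_q ^+ s.+1); last first.
    by rewrite /Q -exprMn -exprSr.
  by ring.
rewrite sumrB -!mulr_sumr big_ord_recr /= -/Q.
set S1 := \sum_(s < n) _; set S0 := \sum_(s < n) _ => e.
have -> : (fps_q ^+ n.+2) ^+ n.+1 = Q ^+ n.+1 * Q.
  by rewrite /Q -exprSr -!exprM mulnC.
have -> : fps_q ^+ (n.+1 ^ 2) = Q ^+ n.+1 by rewrite -exprM mulnn.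
set u := gquot n in gS t_n e *; set v := gquot n.+1 in gS *; set R := Q ^+ n.+1 in e *.
set t := gterm n in t_n *.
have uU : u \is a GRing.unit by apply: gU.
have vU : v \is a GRing.unit by apply: gU.
have QU : 1 + Q \is a GRing.unit by apply: unit_1Dq.
(* Multiplying by these units clears the inverses; [gS] and [t_n] then eliminate [u], leaving an
   identity linear in [S1] and [S0]. *)
apply: (mulrI uU); apply: (mulrI vU); apply: (mulrI QU).
have -> : (1 + Q) * (v * (u * (v^-1 * (1 + 2 * (S1 + t * (R * Q))))))
  = (v / v) * ((u * (1 + Q)) * (1 + 2 * (S1 + t * (R * Q)))) by ring.
rewrite divrr // -gS.
have -> : (1 + Q) * (v * (u * (u^-1 * (1 + 2 * S0) + 2 * ((-1) ^+ n.+1 * R))))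
   = v * ((u / u) * (1 + Q) * (1 + 2 * S0)) +  v * ((1 + Q) * 2 * R * ((-1) ^+ n.+1 * u)) by ring.
rewrite divrr // -t_n.
have {}e : (1 - Q) * S1 = (1 + Q) * S0 + Q + R * (t * (1 - Q)).
  by apply/eqP; rewrite -subr_eq0; apply/eqP; move/eqP: e; rewrite -subr_eq0 => /eqP <-; rewrite t_n; ring.
rewrite (_ : 1 * (v * (1 - Q) * (1 + 2 * (S1 + t * (R * Q)))) =
  v * ((1 - Q) * (1 + 2 * t * (R * Q)) + 2 * ((1 - Q) * S1))); last by ring.
by rewrite e; ring.
Qed.

(** * Squares modulo 8 and the parity sections of [theta] *)

Definition square (n : nat) : bool := has (fun s => s * s == n)%N (iota 0 n.+1).

Lemma squareP n : reflect (exists s, n = s * s)%N (square n).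
Proof.
apply: (iffP hasP) => [[s _ /eqP <-] | [s ->]]; first by exists s.
by exists s => //; rewrite mem_iota; nia.
Qed.

(** For s = 2t + 1 the square is 4t(t + 1) + 1, and t(t + 1) is even. *)
Lemma odd_square s : odd s -> exists w, (s * s = 8 * w + 1)%N.
Proof.
move=> os; have := odd_double_half s; rewrite os => <-; set t := s./2.
exists ((t * t.+1)./2); have : ~~ odd (t * t.+1) by rewrite oddM oddS andbN.
by have := odd_double_half (t * t.+1); case: odd => //=; nia.
Qed.

Lemma square_4 n : square (4 * n) = square n.
Proof.
apply/squareP/squareP => [[s e] | [s ->]]; last by exists (2 * s)%N; lia.
by exists s./2; have := odd_double_half s; case: (odd s) => /=; nia.
Qed.

Lemma square_4D2 n : square (4 * n + 2) = false.
Proof.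
apply/squareP => -[s e].
by have := odd_double_half s; case: (odd s) => /=; nia.
Qed.

Lemma square_odd n r : (r < 4)%N -> square (8 * n + (2 * r + 1)) -> r = 0%N.
Proof.
move=> r4 /squareP [s e].
have /odd_square [w] : odd s.
  by have := congr1 odd e; rewrite oddM andbb => <-; lia.
by lia.
Qed.

Definition theta : fps :=
  Fps (fun n => if n is 0 then 1 else if square n then 2 else 0).

(* [8 * n + 1] is a square iff [n] is a triangular number. *)
Definition psi : fps := Fps (fun n => if square (8 * n + 1) then 1 else 0).

(** An even square is 4 times a square, so the even part of [theta] is theta(q^4). *)
Lemma section0_theta : section 0 theta = dilate theta.
Proof.
apply: fpsP => n; rewrite /= addn0.
move: (odd n) n./2 (odd_double_half n) => b h <-; case: b.
  rewrite (_ : 2 * (true + h.*2) = (4 * h + 2))%N; last by rewrite /=; lia.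
  by rewrite square_4D2; case: (_ + 2)%N (addn2 (4 * h)) => // ->.
rewrite (_ : 2 * (false + h.*2) = 4 * h)%N; last by rewrite /=; lia.
by rewrite square_4; case: h => [|h]; rewrite ?muln0 ?mulnS.
Qed.

(** An odd square is 8w + 1, so its index in the odd section is 4w; hence the double dilation. *)
Lemma section1_theta : section 1 theta = 2 * dilate (dilate psi).
Proof.
have d2 (a : fps) n : (2 * a) n = 2 * a n by rewrite !mulr_natl !mulr2n.
apply: fpsP => n; rewrite d2 /=.
rewrite addn1 /=.
case: ifP => sq.
  (* With n = 4w + r and r < 4 one has 2n + 1 = 8w + 2r + 1, and [square_odd] forces r = 0. *)
  have e : ((2 * n).+1 = 8 * n./2./2 + (2 * (n./2 %% 2 * 2 + n %% 2) + 1))%N by lia.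
  have r0 : (n./2 %% 2 * 2 + n %% 2 = 0)%N.
    by rewrite e in sq; apply: square_odd sq; lia.
  have -> : odd n = false by lia.
  have -> : odd n./2 = false by lia.
  by move: sq; rewrite e r0 /= => ->; rewrite mulr1.
case: ifP => on; first by rewrite mulr0.
case: ifP => on2; first by rewrite mulr0.
rewrite (_ : (8 * _ + 1 = (2 * n).+1)%N); last lia.
by rewrite sq mulr0.
Qed.

(** * Gauss's product formula for [flip theta] *)

Lemma fps_coef_sum I (r : seq I) (F : I -> fps) n :
  (\sum_(i <- r) F i) n = \sum_(i <- r) F i n.
Proof. by apply: (big_morph (fun a : fps => a n)) => [x y|]. Qed.

Lemma fps_coef_sign k (a : fps) n : ((-1) ^+ k * a) n = (-1) ^+ k * a n.
Proof. by rewrite -(signr_odd fps) -(signr_odd int) !mulr_sign; case: odd. Qed.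

(** A square up to [N] has a root at most [N], so no term is missing; a square has the parity of its
    root, which gives the sign. *)
Lemma congq_theta N :
  congq N.+1 (flip theta) (1 + 2 * \sum_(s < N) (-1) ^+ s.+1 * fps_q ^+ (s.+1 ^ 2)).
Proof.
apply/congqE => n; rewrite ltnS => len.
rewrite fps_coefD mulr_natl mulr2n fps_coefD -mulr2n -mulr_natl fps_coef_sum.
rewrite (eq_bigr (fun s : 'I_N => (-1) ^+ s.+1 * (n == s.+1 ^ 2)%N%:R)); last first.
  by move=> s _; rewrite fps_coef_sign fps_coef_qXn.
case: n len => [|n] len; first by rewrite /= big1 ?mulr1 ?mulr0 ?addr0 // => s _; rewrite mulr0.
rewrite fps_coef1 add0r /=; case: squareP => [[[|m] e] | nsq]; first by lia.
  have ltm : (m < N)%N by nia.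
  rewrite (bigD1 (Ordinal ltm)) //= -mulnn -e eqxx big1 => [|s /eqP ns].
    by rewrite e -signr_odd oddM andbb signr_odd mulr1 addr0 mulrC.
  rewrite e; case: eqP => [|_]; last by rewrite mulr0.
  by move=> e'; case: ns; apply: val_inj => /=; nia.
rewrite big1 ?mulr0 // => s _; case: eqP => [e | _]; last by rewrite mulr0.
by case: nsq; exists s.+1; rewrite mulnn.
Qed.

(** In [shanks] at [N.+1] the left-hand sum is divisible by q^(N+2), so [flip theta] agrees with
    [(gquot N.+1)^-1] modulo q^(N+1). *)
Lemma flip_theta_f : flip theta * f_ 2 = f_ 1 ^+ 2.
Proof.
apply: congq_eq => N; apply: (@congqS _ N.+1) => //.
have c1 : congq N.+1 (f_ 1) (fpart 1 N.+1) by apply: congq_f.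
have c2 : congq N.+1 (f_ 2) (fpart 2 N.+1) by apply: congq_f.
have cg : congq N.+1 (flip theta) (gquot N.+1)^-1.
  apply: congqS (etrans (congq_theta N.+1) _) => //; rewrite -shanks.
  apply/congqE => n ltn; rewrite mulrDr mulr1 fps_coefD.
  rewrite [X in _ + X](_ : _ = 0) ?addr0 //.
  have -> : \sum_(s < N.+1) gterm s * (fps_q ^+ N.+2) ^+ s.+1 =
     fps_q ^+ N.+2 * \sum_(s < N.+1) gterm s * (fps_q ^+ N.+2) ^+ s.
    by rewrite mulr_sumr; apply: eq_bigr => s _; rewrite exprS; ring.
  set S := \sum_(s < _) _.
  rewrite (_ : (gquot N.+1)^-1 * _ = fps_q ^+ N.+2 * ((gquot N.+1)^-1 * (2 * S))); last by ring.
  by rewrite fps_coef_qXnM ltn.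
apply: etrans (congqM cg c2) _; rewrite expr2; apply: etrans (esym (congqM c1 c1)).
congr fps_trunc; rewrite fpart2 /gquot invrM ?ppart_unit ?unitrV ?fpart_unit // invrK.
rewrite -[RHS]mulr1 -[X in _ = _ * X](mulVr (ppart_unit N.+1)); ring.
Qed.

(** * The product formula for [psi] *)

Lemma fps_coefMn (a : fps) m n : (a *+ m) n = a n *+ m.
Proof. by elim: m => // m IHm; rewrite !mulrS fps_coefD IHm. Qed.

Lemma fps_natI m (a b : fps) : (0 < m)%N -> m%:R * a = m%:R * b -> a = b.
Proof.
move=> m0; rewrite !mulr_natl => e; apply: fpsP => n; apply: (pmulrnI m0).
by rewrite -!fps_coefMn e.
Qed.

Lemma fps_coef0M (a b : fps) : (a * b) 0%N = a 0%N * b 0%N.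
Proof. by rewrite fps_coefM big_ord1. Qed.

(** If the coefficients of index 1 to n vanish, the next one is 2 w_(n+1) in w^2, while in
    [dilate w] it is 0 or the coefficient of index (n + 1) / 2, which vanishes already. *)
Lemma sqr_eq_dilate (w : fps) : w 0%N = 1 -> w ^+ 2 = dilate w -> w = 1.
Proof.
move=> w0 e; apply: fpsP => n; elim/ltn_ind: n => -[|n] IHn; first by rewrite w0.
have {}IHn m : (0 < m <= n)%N -> w m = 0.
  by case: m => // m lem; rewrite IHn.
have := congr1 (fun a : fps => a n.+1) e.
rewrite expr2 fps_coefM big_ord_recr big_ord_recl /= subnn w0 mul1r mulr1 subn0.
rewrite big1 => [|i _]; last first.
  by rewrite IHn ?mul0r // /bump /=; have := ltn_ord i; lia.
have -> : (if ~~ odd n then 0 else w (uphalf n)) = 0.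
  by case: ifP => // on; apply: IHn; lia.
by rewrite addr0; lia.
Qed.

Lemma f_coef0 t : f_ t 0%N = 1.
Proof. by rewrite /= big_geq. Qed.

Lemma f_2E : f_ 2 = dilate (f_ 1).
Proof. by rewrite dilate_f. Qed.

Lemma f_4E : f_ 4 = dilate (f_ 2).
Proof. by rewrite dilate_f. Qed.

Lemma theta_f : theta * f_ 2 = flip (f_ 1) ^+ 2.
Proof.
rewrite -rmorphXn /= -flip_theta_f rmorphM /= flipK; congr (_ * _).
by rewrite f_2E flip_dilate.
Qed.

(** After multiplication by f_2^2 f_4^2 both sides equal f_2^6, by Gauss's product and [f_flip]. *)
Lemma theta_flip : theta * flip theta = dilate (flip theta ^+ 2).
Proof.
have e4 := f_flip; have e2 := theta_f; have e1 := flip_theta_f.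
have ed : dilate (flip theta) * f_ 4 = f_ 2 ^+ 2.
  by rewrite f_4E -rmorphM e1 rmorphXn /= -f_2E.
apply: (mulrI (unitrX 2 (f_unit 2))); apply: (mulrI (unitrX 2 (f_unit 4))).
transitivity (f_ 4 ^+ 2 * (theta * f_ 2) * (flip theta * f_ 2)); first by ring.
rewrite e2 e1; transitivity ((f_ 1 * flip (f_ 1) * f_ 4) ^+ 2); first by ring.
rewrite e4 rmorphXn /=; transitivity (f_ 2 ^+ 2 * (dilate (flip theta) * f_ 4) ^+ 2).
  by rewrite ed; ring.
by ring.
Qed.

(** [theta_flip] and [mulr_flip] evaluate the same product [theta * flip theta]. *)
Lemma flip_theta_sqr :
  flip theta ^+ 2 = dilate (theta ^+ 2) - fps_q * dilate (4 * dilate psi ^+ 2).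
Proof.
apply: dilate_inj; rewrite -theta_flip mulr_flip section0_theta section1_theta.
by congr dilate; rewrite (rmorphM _ 4) !rmorphXn rmorph_nat /=; ring.
Qed.

(** Odd sections are compared in [flip_theta_sqr] and in the square of the parity decomposition of
    [flip theta]; a factor 4 and one dilation cancel. *)
Lemma psi_sqr : psi ^+ 2 = theta * dilate psi.
Proof.
have e : flip theta = dilate (dilate theta) - fps_q * dilate (2 * dilate (dilate psi)).
  rewrite [in LHS](parity_split theta) rmorphD rmorphM /= flip_q !flip_dilate.
  by rewrite section0_theta section1_theta mulNr.
have := flip_theta_sqr.
rewrite e (_ : _ ^+ 2 = dilate (dilate theta ^+ 2 + fps_q * (2 * dilate (dilate psi)) ^+ 2)
   - fps_q * dilate (4 * dilate theta * dilate (dilate psi))); last first.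
  rewrite rmorphD (rmorphM _ fps_q) !rmorphXn /= dilate_q !rmorphM !rmorph_nat /=.
  by ring.
move=> /(congr1 (section 1)); rewrite !raddfB /= !section1_dilate !section1_qM !sub0r.
move=> /oppr_inj; rewrite -mulrA => /(@fps_natI 4) -/(_ isT).
by rewrite -rmorphM -rmorphXn => /dilate_inj.
Qed.

(** The quotient [w] of the two sides satisfies w^2 = w(q^2) by [psi_sqr], [theta_f] and [f_flip],
    so [sqr_eq_dilate] applies. *)
Lemma psi_f : psi * f_ 1 = f_ 2 ^+ 2.
Proof.
have u2 : f_ 2 ^+ 2 \is a GRing.unit by apply: unitrX; apply: f_unit.
have u4 : f_ 4 ^+ 2 \is a GRing.unit by apply: unitrX; apply: f_unit.
pose w := psi * f_ 1 / f_ 2 ^+ 2.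
have ew : w * f_ 2 ^+ 2 = psi * f_ 1 by rewrite divrK.
suff w1 : w = 1 by rewrite -ew w1 mul1r.
apply: sqr_eq_dilate.
  have : w 0%N * (f_ 2 0%N * f_ 2 0%N) = psi 0%N * f_ 1 0%N.
    by rewrite -!fps_coef0M -expr2 ew.
  by rewrite !f_coef0 !mulr1.
have edw : dilate w * f_ 4 ^+ 2 = dilate psi * f_ 2.
  by rewrite f_4E -rmorphXn -rmorphM ew rmorphM /= -f_2E.
apply: (mulIr u4); rewrite edw; apply: (mulIr u2); apply: (mulIr u2).
(* This extra factor completes [theta] to [theta * f_ 2]. *)
apply: (mulIr (f_unit 2)).
transitivity ((w * f_ 2 ^+ 2) ^+ 2 * f_ 4 ^+ 2 * f_ 2); first by ring.
rewrite ew; transitivity (psi ^+ 2 * f_ 1 ^+ 2 * f_ 4 ^+ 2 * f_ 2); first by ring.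
rewrite psi_sqr.
transitivity (dilate psi * (theta * f_ 2) * (f_ 1 * f_ 4) ^+ 2); first by ring.
rewrite theta_f.
transitivity (dilate psi * (f_ 1 * flip (f_ 1) * f_ 4) ^+ 2); first by ring.
by rewrite f_flip; ring.
Qed.

(** * Parity sections of powers of [f_ 1] *)

(** By Gauss, f_1^8 = f_2^4 (flip theta)^4; the factor f_2^4 leaves the section as f_1^4 and
    completes psi^4 to (psi f_1)^4 = f_2^8. *)
Lemma section1_f8 : section 1 (f_ 1 ^+ 8) = - 8 * f_ 2 ^+ 8.
Proof.
have -> : f_ 1 ^+ 8 = dilate (f_ 1 ^+ 4) * (flip theta ^+ 2) ^+ 2.
  rewrite rmorphXn /= -f_2E (_ : f_ 1 ^+ 8 = (f_ 1 ^+ 2) ^+ 4); last by ring.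
  by rewrite -flip_theta_f; ring.
rewrite section_dilateM // flip_theta_sqr.
rewrite (_ : (_ - _) ^+ 2 = dilate (theta ^+ 4 + fps_q * (4 * dilate psi ^+ 2) ^+ 2)
   - fps_q * dilate (8 * (theta * dilate psi) ^+ 2)); last first.
  rewrite rmorphD (rmorphM _ fps_q) !rmorphXn /= dilate_q (rmorphM _ 4) (rmorphM _ 8).
  by rewrite !rmorphXn (rmorphM _ theta) !rmorph_nat /=; ring.
rewrite raddfB /= section1_dilate section1_qM -psi_sqr.
transitivity (- 8 * (psi * f_ 1) ^+ 4); first by ring.
by rewrite psi_f; ring.
Qed.

Lemma section0_f8_sqr :
  f_ 2 ^+ 8 * (section 0 (f_ 1 ^+ 8) ^+ 2 - 64 * fps_q * f_ 2 ^+ 16) = f_ 1 ^+ 24.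
Proof.
apply: dilate_inj.
have -> : section 0 (f_ 1 ^+ 8) ^+ 2 - 64 * fps_q * f_ 2 ^+ 16
  = section 0 (f_ 1 ^+ 8) ^+ 2 - fps_q * section 1 (f_ 1 ^+ 8) ^+ 2.
  by rewrite section1_f8; ring.
rewrite (rmorphM _ (f_ 2 ^+ 8)) /= -mulr_flip !rmorphXn /= -f_2E -f_4E.
transitivity ((f_ 1 * flip (f_ 1) * f_ 4) ^+ 8); first by ring.
by rewrite f_flip; ring.
Qed.

Lemma parity_split_sqr a b : (dilate a + fps_q * dilate b) ^+ 2 =
  dilate (a * a + fps_q * b * b) + fps_q * dilate (a * b + a * b).
Proof. by rewrite !rmorphD !rmorphM /= dilate_q; ring. Qed.

Lemma parity_split_cube a b : (dilate a + fps_q * dilate b) ^+ 3 =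
  dilate (a * a * a + (fps_q * a * b * b) *+ 3)
  + fps_q * dilate ((a * a * b) *+ 3 + fps_q * b * b * b).
Proof. by rewrite !rmorphD !rmorphM /= dilate_q; ring. Qed.

(** With a and b the sections of f_1^8, the even section of the square is a^2 + q b^2 = (a^2 - q
    b^2) + 2 q b^2, where b^2 = 64 f_2^16. *)
Lemma section0_f16 :
  section 0 (f_ 1 ^+ 16) = 128 * (fps_q * f_ 2 ^+ 16) + f_ 1 ^+ 24 / f_ 2 ^+ 8.
Proof.
have u : f_ 2 ^+ 8 \is a GRing.unit by rewrite unitrX ?f_unit.
apply: (mulIr u); rewrite mulrDl divrK // -section0_f8_sqr.
rewrite (_ : f_ 1 ^+ 16 = (f_ 1 ^+ 8) ^+ 2); last by ring.
rewrite [in LHS](parity_split (f_ 1 ^+ 8)) parity_split_sqr raddfD /=.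
by rewrite section0_dilate section0_qM section1_f8; ring.
Qed.

(** In the same notation the odd section of the cube is 3 a^2 b + q b^3; putting b = -8 f_2^8 and
    a^2 f_2^8 = f_1^24 + 64 q f_2^24 gives -2048 as -24 * 64 - 512. *)
Lemma section1_f24 :
  section 1 (f_ 1 ^+ 24) = - 24 * f_ 1 ^+ 24 - 2048 * (fps_q * f_ 2 ^+ 24).
Proof.
rewrite -[in RHS]section0_f8_sqr.
rewrite (_ : f_ 1 ^+ 24 = (f_ 1 ^+ 8) ^+ 3); last by ring.
rewrite [in LHS](parity_split (f_ 1 ^+ 8)) parity_split_cube raddfD /=.
by rewrite section1_dilate section1_qM section1_f8; ring.
Qed.

Lemma section1_flip a : section 1 (flip a) = - section 1 a.
Proof. by apply: fpsP => n /=; rewrite addn1 -signr_odd /= oddM /= expr1 mulN1r. Qed.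

(** By [f_flip], f_2^24 / f_1^8 = f_4^8 flip(f_1^8), which reduces the inverse to the known section
    of f_1^8. *)
Lemma section1_fN8 : section 1 (f_ 1 ^+ 8)^-1 = 8 * f_ 2 ^+ 16 / f_ 1 ^+ 24.
Proof.
have u : f_ 1 ^+ 24 \is a GRing.unit by rewrite unitrX ?f_unit.
have u8 : f_ 1 ^+ 8 \is a GRing.unit by rewrite unitrX ?f_unit.
apply: (mulrI u); rewrite [RHS]mulrC divrK // -section_dilateM //.
have -> : dilate (f_ 1 ^+ 24) * (f_ 1 ^+ 8)^-1 = dilate (f_ 2 ^+ 8) * flip (f_ 1 ^+ 8).
  apply: (mulIr u8); rewrite divrK // !rmorphXn /= -f_2E -f_4E.
  rewrite (_ : f_ 2 ^+ 24 = (f_ 2 ^+ 3) ^+ 8); last by ring.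
  by rewrite -f_flip; ring.
by rewrite section_dilateM // section1_flip section1_f8; ring.
Qed.

Lemma section0_qMl a : section 0 (fps_q * a) = fps_q * section 1 a.
Proof.
rewrite [in LHS](parity_split a) (_ : fps_q * _ = fps_q * dilate (section 0 a)
  + dilate (fps_q * section 1 a)).
  by rewrite raddfD /= section0_qM section0_dilate add0r.
by rewrite rmorphM /= dilate_q; ring.
Qed.

(** * The two families of right-hand sides and their sections *)

Definition even_form (k : nat) (a b : int) : fps :=
  a%:~R * f_ 1 ^ (8 * k%:Z)
  + b%:~R * (fps_q ^+ (k %/ 2) * (f_ 1 ^ (8 * k%:Z - 24) * f_ 2 ^+ 24)).

(** The right-hand side of the second identity times q^(k %/ 2), which makes it a power series;
    [odd_formE] undoes this by a shift. *)
Definition odd_form (k : nat) (a b : int) : fps :=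
  a%:~R * (fps_q ^+ (k %/ 2) * f_ 2 ^ (8 * k%:Z))
  + b%:~R * (f_ 1 ^+ 24 * f_ 2 ^ (8 * k%:Z - 24)).

Lemma section_lin r (a b : int) (x y : fps) :
  section r (a%:~R * x + b%:~R * y) = a%:~R * section r x + b%:~R * section r y.
Proof. by rewrite !mulrzl raddfD !raddfMz. Qed.

Lemma dilate_f24 : dilate (f_ 1 ^+ 24) = f_ 2 ^+ 24.
Proof. by rewrite rmorphXn /= -f_2E. Qed.

Lemma even_form1E a : even_form 1 a 0 = a%:~R * f_ 1 ^+ 8.
Proof. by rewrite /even_form mul0r addr0. Qed.

Lemma odd_form1E a : odd_form 1 a 0 = a%:~R * f_ 2 ^+ 8.
Proof. by rewrite /odd_form mul0r addr0 -[(1 %/ 2)%N]/0%N expr0 mul1r. Qed.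

Lemma even_form2E a b : even_form 2 a b =
  a%:~R * f_ 1 ^+ 16 + b%:~R * (dilate (f_ 1 ^+ 24) * (fps_q * (f_ 1 ^+ 8)^-1)).
Proof.
have e1 : f_ 1 ^ (8 * 2%:Z) = f_ 1 ^+ 16 by [].
have e2 : f_ 1 ^ (8 * 2%:Z - 24) = (f_ 1 ^+ 8)^-1 by [].
rewrite /even_form e1 e2 dilate_f24 -[(2 %/ 2)%N]/1%N expr1.
by congr (_ + _ * _); ring.
Qed.

Lemma odd_form2E a b : odd_form 2 a b =
  a%:~R * (fps_q * dilate (f_ 1 ^+ 16)) + b%:~R * (dilate (f_ 1 ^+ 8)^-1 * f_ 1 ^+ 24).
Proof.
have e1 : f_ 2 ^ (8 * 2%:Z) = dilate (f_ 1 ^+ 16) by rewrite rmorphXn /= -f_2E.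
have e2 : f_ 2 ^ (8 * 2%:Z - 24) = dilate (f_ 1 ^+ 8)^-1.
  by rewrite rmorphV ?unitrX ?f_unit // rmorphXn /= -f_2E.
rewrite /odd_form e1 e2 -[(2 %/ 2)%N]/1%N expr1.
by rewrite [f_ 1 ^+ 24 * _]mulrC.
Qed.

Lemma even_form3E a b : even_form 3 a b =
  a%:~R * f_ 1 ^+ 24 + b%:~R * (fps_q * dilate (f_ 1 ^+ 24)).
Proof.
have e1 : f_ 1 ^ (8 * 3%:Z) = f_ 1 ^+ 24 by [].
have e2 : f_ 1 ^ (8 * 3%:Z - 24) = 1 by [].
by rewrite /even_form e1 e2 dilate_f24 mul1r -[(3 %/ 2)%N]/1%N expr1.
Qed.

Lemma odd_form3E a b : odd_form 3 a b =
  a%:~R * (fps_q * dilate (f_ 1 ^+ 24)) + b%:~R * f_ 1 ^+ 24.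
Proof.
have e1 : f_ 2 ^ (8 * 3%:Z) = f_ 2 ^+ 24 by [].
have e2 : f_ 2 ^ (8 * 3%:Z - 24) = 1 by [].
by rewrite /odd_form e1 e2 dilate_f24 mulr1 -[(3 %/ 2)%N]/1%N expr1.
Qed.

Lemma section_even_form1 a :
  section 1 (even_form 1 a 0) = odd_form 1 (- 8 * a) 0.
Proof.
rewrite even_form1E odd_form1E mulrzl raddfMz /= section1_f8 -mulrzl.
by rewrite rmorphM rmorphN /=; ring.
Qed.

Lemma section_odd_form1 a : section 0 (odd_form 1 a 0) = even_form 1 a 0.
Proof.
rewrite even_form1E odd_form1E f_2E -rmorphXn /= !mulrzl raddfMz /=.
by rewrite section0_dilate.
Qed.

Lemma unit_mulrCA_div (x y z : fps) :
  x \is a GRing.unit -> x * (y * (z / x)) = y * z.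
Proof. by move=> u; rewrite mulrCA [x * _]mulrC divrK. Qed.

Lemma section_even_form2 a b :
  section 0 (even_form 2 a b) = odd_form 2 (128 * a + 8 * b) a.
Proof.
have u : f_ 1 ^+ 24 \is a GRing.unit by rewrite unitrX ?f_unit.
have e2 : dilate (f_ 1 ^+ 8)^-1 = (f_ 2 ^+ 8)^-1.
  by rewrite rmorphV ?unitrX ?f_unit // rmorphXn /= -f_2E.
have e16 : dilate (f_ 1 ^+ 16) = f_ 2 ^+ 16 by rewrite rmorphXn /= -f_2E.
rewrite even_form2E odd_form2E section_lin section_dilateM // section0_qMl.
rewrite section1_fN8 section0_f16 e2 e16.
(* The denominator from [section1_fN8] cancels against the f_1^24 taken out of the section. *)
have -> : f_ 1 ^+ 24 * (fps_q * (8 * f_ 2 ^+ 16 / f_ 1 ^+ 24)) = fps_q * (8 * f_ 2 ^+ 16).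
  exact: unit_mulrCA_div.
by rewrite rmorphD !rmorphM /=; ring.
Qed.

Lemma section_odd_form2 a b :
  section 1 (odd_form 2 a b) = even_form 2 (a - 24 * b) (- 2048 * b).
Proof.
have u : f_ 1 ^+ 8 \is a GRing.unit by rewrite unitrX ?f_unit.
rewrite even_form2E odd_form2E section_lin section_dilateM // section1_qM.
rewrite section1_f24 dilate_f24 (_ : f_ 1 ^+ 16 = f_ 1 ^+ 24 / f_ 1 ^+ 8).
  by rewrite rmorphB !rmorphM rmorphN /=; ring.
by rewrite -[24%N]/(16 + 8)%N exprD (mulrK u).
Qed.

Lemma section_even_form3 a b :
  section 1 (even_form 3 a b) = odd_form 3 (- 2048 * a) (- 24 * a + b).
Proof.
rewrite even_form3E odd_form3E section_lin section1_qM section1_f24 dilate_f24.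
by rewrite rmorphD !rmorphM !rmorphN /=; ring.
Qed.

Lemma section_odd_form3 a b :
  section 1 (odd_form 3 a b) = even_form 3 (a - 24 * b) (- 2048 * b).
Proof.
rewrite even_form3E odd_form3E section_lin section1_qM section1_f24 dilate_f24.
by rewrite rmorphB !rmorphM rmorphN /=; ring.
Qed.

(** * Coefficients in progressions and the passage to Laurent series *)

(** This is (4^alpha - 1) / 3, see [pow4_sumE]. *)
Definition pow4_sum (alpha : nat) : nat := \sum_(i < alpha) 4 ^ i.

Lemma pow4_sumS n : pow4_sum n.+1 = (pow4_sum n + 4 ^ n)%N.
Proof. by rewrite /pow4_sum big_ord_recr. Qed.

Lemma pow4_sumE alpha : (3 * pow4_sum alpha + 1 = 4 ^ alpha)%N.
Proof.
elim: alpha => [|n IHn]; first by rewrite /pow4_sum big_ord0.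
by rewrite pow4_sumS expnS; lia.
Qed.

Definition progression (F : fps) (k alpha : nat) : fps :=
  Fps (fun n => F (4 ^ alpha * n + k * pow4_sum alpha)%N).

Lemma progression0 F k : progression F k 0 = F.
Proof. by apply: fpsP => n; rewrite /= /pow4_sum big_ord0 muln0 addn0 mul1n. Qed.

(** Raising [alpha] by one substitutes 4n + k for n, and 4n + k = 2(2n + k %/ 2) + k %% 2 splits
    this into two sections. *)
Lemma progressionS F k alpha : progression F k alpha.+1 =
  section (k %/ 2) (section (k %% 2) (progression F k alpha)).
Proof.
apply: fpsP => n /=; congr (fps_coef F _).
rewrite pow4_sumS expnS.
move: (k %/ 2)%N (k %% 2)%N (divn_eq k 2) (4 ^ alpha)%N (pow4_sum alpha) => q r -> P S.
by ring.
Qed.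

Lemma exp2_pow4 n : (2 : int) ^+ (2 * n) = (4 ^ n)%N.
Proof. by elim: n => // n IHn; rewrite mulnS exprD IHn expnS PoszM. Qed.

Lemma div3_pow4 (k alpha : nat) :
  (k%:Z * (2 ^+ (2 * alpha) - 1) %/ 3)%Z = (k * pow4_sum alpha)%N.
Proof.
have -> : (2 : int) ^+ (2 * alpha) = (3 * pow4_sum alpha + 1)%N.
  by rewrite pow4_sumE exp2_pow4.
by rewrite PoszD PoszM addrK mulrA [k%:Z * 3]mulrC -mulrA mulKz.
Qed.

Lemma p_nat (j : int) (n : nat) : p_ j n = (f_ 1 ^ j) n.
Proof. by rewrite /p_ lau_shiftE subr0. Qed.

Lemma lau_series_even (k alpha : nat) (j : int) :
  lau_series 0 (fun n =>
      p_ j (2 ^+ (2 * alpha) * n + (k%:Z * (2 ^+ (2 * alpha) - 1) %/ 3)%Z))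
  = lau_of_fps (progression (f_ 1 ^ j) k alpha).
Proof.
apply: laurentP => n; rewrite /= div3_pow4; case: ifP => // n0.
by case: n n0 => // n _; rewrite exp2_pow4 -PoszM -PoszD p_nat subr0.
Qed.

(** With n = m - k %/ 2 and m >= 0 the argument becomes 4^alpha (2m + k %% 2) + k [pow4_sum alpha]:
    one more section of the progression, shifted. *)
Lemma lau_series_odd (k alpha : nat) (j : int) :
  lau_series (- (k %/ 2)%N%:Z) (fun n =>
      p_ j (2 ^+ (2 * alpha + 1) * n + (k%:Z * (2 ^+ (2 * alpha + 2) - 1) %/ 3)%Z))
  = lau_shift (- (k %/ 2)%N%:Z)
      (section (k %% 2) (progression (f_ 1 ^ j) k alpha)).
Proof.
apply: laurentP => n /=; case: ifP => // n0.
rewrite (_ : 2 * alpha + 2 = 2 * alpha.+1)%N ?div3_pow4; last lia.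
have [m ->] : exists m : nat, n = m%:Z - (k %/ 2)%N%:Z by exists (absz (n + (k %/ 2)%N%:Z)); lia.
rewrite {n n0} (_ : _ * _ + _ = (4 ^ alpha * (2 * m + k %% 2) + k * pow4_sum alpha)%N%:Z).
  by rewrite p_nat opprK subrK.
rewrite exprD exp2_pow4 pow4_sumS.
move: (k %/ 2)%N (k %% 2)%N (divn_eq k 2) (4 ^ alpha)%N (pow4_sum alpha) => q r -> P S.
by rewrite !PoszD !PoszM !PoszD !PoszM; ring.
Qed.

Lemma lau_of_fps_lin (m : nat) (a b : int) (x y : fps) :
  lau_of_fps (a%:~R * x + b%:~R * (fps_q ^+ m * y))
  = a%:~R * lau_of_fps x + b%:~R * lau_qX m * lau_of_fps y.
Proof.
rewrite rmorphD rmorphM rmorph_int rmorphM rmorph_int /=; congr (_ + _).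
rewrite -mulrA lau_qXM; congr (_ * _).
by rewrite -(lau_shift_qXn _ m) subrr.
Qed.

Lemma lau_shift_lin (m : nat) (a b : int) (x y : fps) :
  lau_shift (- m%:Z) (a%:~R * (fps_q ^+ m * x) + b%:~R * y)
  = a%:~R * lau_of_fps x + b%:~R * lau_qX (- m%:Z) * lau_of_fps y.
Proof.
rewrite -lau_qXM rmorphD !(rmorphM _ _%:~R) !rmorph_int /= mulrDr.
congr (_ + _); last by rewrite mulrCA mulrA.
rewrite mulrCA lau_qXM; congr (_ * _).
by rewrite -[- _]add0r lau_shift_qXn.
Qed.

Lemma even_formE k a b : lau_of_fps (even_form k a b)
  = a%:~R * lau_of_fps (f_ 1 ^ (8 * k%:Z))
      + b%:~R * lau_qX (k %/ 2)%N * lau_of_fps (f_ 1 ^ (8 * k%:Z - 24) * f_ 2 ^+ 24).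
Proof. exact: lau_of_fps_lin. Qed.

Lemma odd_formE k a b : lau_shift (- (k %/ 2)%N%:Z) (odd_form k a b)
  = a%:~R * lau_of_fps (f_ 2 ^ (8 * k%:Z))
      + b%:~R * lau_qX (- (k %/ 2)%N%:Z)
        * lau_of_fps (f_ 1 ^+ 24 * f_ 2 ^ (8 * k%:Z - 24)).
Proof. exact: lau_shift_lin. Qed.

(** * Matching the recurrences with the action of the sections *)

(** The recurrence links indices of one parity only and has order two there, so a relation between
    such sequences need only be checked at [m] and [m.+2]. *)
Lemma linear_relation k (s t u : nat -> int) (a b : int) m :
  satisfies_rec k s -> satisfies_rec k t -> satisfies_rec k u ->
  s m.+1 = a * t m + b * u m ->
  s m.+3 = a * t m.+2 + b * u m.+2 ->
  forall n, s (2 * n + m.+1)%N = a * t (2 * n + m)%N + b * u (2 * n + m)%N.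
Proof.
move=> rs rt ru e0 e1 n.
pose P i := s (2 * i + m.+1)%N = a * t (2 * i + m)%N + b * u (2 * i + m)%N.
suff [] : P n /\ P n.+1 by [].
elim: n => // n [p0 p1]; split=> //; rewrite /P.
have E x : (2 * n.+2 + x = 2 * n + x + 4)%N by lia.
have E1 x : (2 * n.+1 + x = 2 * n + x + 2)%N by lia.
by rewrite !E rs rt ru -!E1 p0 p1; ring.
Qed.

(** The residues are those of [progressionS], so the two clauses together raise [alpha] by one. *)
Definition form_step k (A B : nat -> int) : Prop := forall n,
  section (k %% 2) (even_form k (A (2 * n)%N) (B (2 * n)%N))
    = odd_form k (A (2 * n + 1)%N) (B (2 * n + 1)%N)
  /\ section (k %/ 2) (odd_form k (A (2 * n + 1)%N) (B (2 * n + 1)%N))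
    = even_form k (A (2 * n + 2)%N) (B (2 * n + 2)%N).

Lemma progression_form k (A B : nat -> int) : A 0%N = 1 -> B 0%N = 0 ->
  form_step k A B -> forall n, progression (f_ 1 ^ (8 * k%:Z)) k n
     = even_form k (A (2 * n)%N) (B (2 * n)%N).
Proof.
move=> A0 B0 step; elim=> [|n IHn].
  by rewrite progression0 /even_form A0 B0 mul1r mul0r addr0.
have [eo oe] := step n.
by rewrite progressionS IHn eo oe (_ : 2 * n.+1 = 2 * n + 2)%N //; lia.
Qed.

Lemma form_step1 (A B : nat -> int) : satisfies_rec 1 A ->
  [/\ A 0%N = 1, A 1%N = - 8, A 2%N = - 8 & A 3%N = 64] ->
  (forall n, B n = 0) -> form_step 1 A B.
Proof.
move=> rA [A0 A1 A2 A3] B0 n; rewrite !B0.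
(* The relation from odd to even indices is tested from 1 to 2 and from 3 to 4, hence the value at
   4. *)
have A4 := rA 0%N; rewrite !add0n /= in A4.
have eA m : A (2 * m + 1)%N = - 8 * A (2 * m + 0)%N + 0 * A (2 * m + 0)%N.
  by apply: (linear_relation rA rA rA); rewrite !(A0, A1, A2, A3); ring.
have eA' m : A (2 * m + 2)%N = 1 * A (2 * m + 1)%N + 0 * A (2 * m + 1)%N.
  by apply: (linear_relation rA rA rA); rewrite !(A4, A1, A2, A3, A0); ring.
split; first by rewrite section_even_form1 eA addn0 mul0r addr0.
by rewrite section_odd_form1 eA' mul1r mul0r addr0.
Qed.

(** The two steps compose to the matrix with rows (104, 8) and (-2048, 0), of trace [frec 2] and
    determinant [- grec 2], whence the recurrence by Cayley-Hamilton. *)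
Lemma form_step2 (A B : nat -> int) : satisfies_rec 2 A -> satisfies_rec 2 B ->
  [/\ A 0%N = 1, A 1%N = 128, A 2%N = 104 & A 3%N = - 3072] ->
  [/\ B 0%N = 0, B 1%N = 1, B 2%N = - 2048 & B 3%N = 104] -> form_step 2 A B.
Proof.
move=> rA rB [A0 A1 A2 A3] [B0 B1 B2 B3] n.
have A4 := rA 0%N; have B4 := rB 0%N; rewrite !add0n /= in A4 B4.
have eA m : A (2 * m + 1)%N = 128 * A (2 * m + 0)%N + 8 * B (2 * m + 0)%N.
  by apply: (linear_relation rA rA rB); rewrite !(A0, B0, A1, A2, B2, A3); ring.
have eB m : B (2 * m + 1)%N = 1 * A (2 * m + 0)%N + 0 * B (2 * m + 0)%N.
  by apply: (linear_relation rB rA rB); rewrite !(A0, B0, B1, A2, B2, B3); ring.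
have eA' m : A (2 * m + 2)%N = 1 * A (2 * m + 1)%N + - 24 * B (2 * m + 1)%N.
  by apply: (linear_relation rA rA rB); rewrite !(A4, A1, A2, A3, A0, B1, B3); ring.
have eB' m : B (2 * m + 2)%N = - 2048 * B (2 * m + 1)%N + 0 * A (2 * m + 1)%N.
  by apply: (linear_relation rB rB rA); rewrite !(B4, B1, B2, B3, B0, A1, A3); ring.
split; first by rewrite section_even_form2 eA eB addn0 mul1r mul0r addr0.
by rewrite section_odd_form2 eA' eB' mul1r mul0r addr0 !mulNr.
Qed.

(** Here the composite has rows (-1472, -24) and (49152, -2048), of trace [frec 3] and determinant
    [- grec 3]. *)
Lemma form_step3 (A B : nat -> int) : satisfies_rec 3 A -> satisfies_rec 3 B ->
  [/\ A 0%N = 1, A 1%N = - 2048, A 2%N = - 1472 & A 3%N = 3014656%:R] ->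
  [/\ B 0%N = 0, B 1%N = - 24, B 2%N = 49152%:R & B 3%N = 84480%:R] ->
  form_step 3 A B.
Proof.
move=> rA rB [A0 A1 A2 A3] [B0 B1 B2 B3] n.
have A4 := rA 0%N; have B4 := rB 0%N; rewrite !add0n /= in A4 B4.
have eA m : A (2 * m + 1)%N = - 2048 * A (2 * m + 0)%N + 0 * B (2 * m + 0)%N.
  by apply: (linear_relation rA rA rB); rewrite !(A0, B0, A1, A2, B2, A3); ring.
have eB m : B (2 * m + 1)%N = - 24 * A (2 * m + 0)%N + 1 * B (2 * m + 0)%N.
  by apply: (linear_relation rB rA rB); rewrite !(A0, B0, B1, A2, B2, B3); ring.
have eA' m : A (2 * m + 2)%N = 1 * A (2 * m + 1)%N + - 24 * B (2 * m + 1)%N.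
  by apply: (linear_relation rA rA rB); rewrite !(A4, A1, A2, A3, A0, B1, B3); ring.
have eB' m : B (2 * m + 2)%N = - 2048 * B (2 * m + 1)%N + 0 * A (2 * m + 1)%N.
  by apply: (linear_relation rB rB rA); rewrite !(B4, B1, B2, B3, B0, A1, A3); ring.
split; first by rewrite section_even_form3 eA eB addn0 mul1r mul0r addr0.
by rewrite section_odd_form3 eA' eB' mul1r mul0r addr0 !mulNr.
Qed.

Theorem theorem1p1 (A B : nat -> nat -> int)
    (recA : forall k, (1 <= k <= 3)%N -> satisfies_rec k (A k))
    (recB : forall k, (1 <= k <= 3)%N -> satisfies_rec k (B k))
    (A1 : [/\ (A 1 0)%N = 1, (A 1 1)%N = - 8, (A 1 2)%N = - 8 & (A 1 3)%N = 64])
    (B1 : forall alpha, (B 1 alpha)%N = 0)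
    (A2 : [/\ (A 2 0)%N = 1, (A 2 1)%N = 128, (A 2 2)%N = 104 & (A 2 3)%N = - 3072])
    (B2 : [/\ (B 2 0)%N = 0, (B 2 1)%N = 1, (B 2 2)%N = - 2048 & (B 2 3)%N = 104])
    (A3 : [/\ (A 3 0)%N = 1, (A 3 1)%N = - 2048, (A 3 2)%N = - 1472 & (A 3 3)%N = 3014656%:R])
    (B3 : [/\ (B 3 0)%N = 0, (B 3 1)%N = - 24, (B 3 2)%N = 49152%:R & (B 3 3)%N = 84480%:R])
    (alpha k : nat) (hk : (1 <= k <= 3)%N) :
  lau_series 0 (fun n =>
      p_ (8 * k%:Z) (2 ^+ (2 * alpha) * n
                     + (k%:Z * (2 ^+ (2 * alpha) - 1) %/ 3)%Z))
    = (A k (2 * alpha)%N)%:~R * lau_of_fps (f_ 1 ^ (8 * k%:Z))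
      + (B k (2 * alpha)%N)%:~R * lau_qX (k %/ 2)%N
        * lau_of_fps (f_ 1 ^ (8 * k%:Z - 24) * f_ 2 ^+ 24)
  /\
  lau_series (- (k %/ 2)%N%:Z) (fun n =>
      p_ (8 * k%:Z) (2 ^+ (2 * alpha + 1) * n
                     + (k%:Z * (2 ^+ (2 * alpha + 2) - 1) %/ 3)%Z))
    = (A k (2 * alpha + 1)%N)%:~R * lau_of_fps (f_ 2 ^ (8 * k%:Z))
      + (B k (2 * alpha + 1)%N)%:~R * lau_qX (- (k %/ 2)%N%:Z)
        * lau_of_fps (f_ 1 ^+ 24 * f_ 2 ^ (8 * k%:Z - 24)).
Proof.
(* Both Laurent identities reduce to power series: the second takes one further section of the
   first. *)
suff [prog eo] : progression (f_ 1 ^ (8 * k%:Z)) k alpha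
     = even_form k (A k (2 * alpha)%N) (B k (2 * alpha)%N) /\
   section (k %% 2) (even_form k (A k (2 * alpha)%N) (B k (2 * alpha)%N))
     = odd_form k (A k (2 * alpha + 1)%N) (B k (2 * alpha + 1)%N).
  by rewrite lau_series_even lau_series_odd prog eo even_formE odd_formE.
have step : form_step k (A k) (B k) /\ A k 0%N = 1 /\ B k 0%N = 0.
  case: k hk => [|[|[|[|k]]]] hk; [exfalso; lia | | | | exfalso; lia].
  - by split; [exact: form_step1 (recA _ hk) A1 B1 | case: A1].
  - by split; [exact: form_step2 (recA _ hk) (recB _ hk) A2 B2 | case: A2; case: B2].
  - split; first exact: form_step3 (recA _ hk) (recB _ hk) A3 B3.
    by case: A3 => -> _ _ _; case: B3 => -> _ _ _.
case: step => step [A0 B0]; split; last by have [] := step alpha.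
exact: progression_form.
Qed.
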